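(* For every integer $n\ge 0$, as polynomials in $x$, $$B_{n}(x)=\sum_{k=0}^{n}(-1)^{n-k}S_{2}(n,k)B_{k}^{L}(x).$$
   Context: $S_2(n,k)$ is the Stirling number of the second kind: the number of ways to partition a set of $n$ elements into $k$ nonempty subsets. The Bell polynomials $B_n(x)$ are defined by $e^{x(e^t-1)}=\sum_{n=0}^\infty B_n(x)\frac{t^n}{n!}$ (equivalently $B_n(x)=\sum_{k=0}^n S_2(n,k)x^k$). For integers $n,k\ge 0$, the unsigned Lah number $L(n,k)$ is the number of ways a set of $n$ elements can be partitioned into $k$ nonempty linearly ordered subsets (so $L(0,0)=1$, $L(n,0)=0$ for $n\ge 1$, $L(n,k)=0$ for $k>n$, and $L(n,k)=\binom{n-1}{k-1}\frac{n!}{k!}$ for $n\ge k\ge 1$). The Lah-Bell polynomials are $B_n^L(x)=\sum_{l=0}^n L(n,l)x^l$ for $n\ge 0$. *)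

(* Defs.v *)
From mathcomp Require Import all_boot all_order all_algebra.

Set Implicit Arguments.
Unset Strict Implicit.
Unset Printing Implicit Defensive.

Import GRing.Theory.
Local Open Scope ring_scope.

Definition stirling2 (n k : nat) : nat :=
  #|[set P : {set {set 'I_n}} | partition P [set: 'I_n] & #|P| == k]|.

(* A linearly ordered subset of 'I_n is a duplicate-free sequence (necessarily
   of size at most n, whence the bounded sequences).  A set Q of sequences is a
   partition of 'I_n into nonempty linearly ordered subsets when none of its
   members is empty and every element of 'I_n occurs exactly once overall. *)
Definition ordered_partition (n : nat) (Q : {set n.-bseq 'I_n}) : bool :=
  [forall s in Q, size s != 0%N] &&
  perm_eq (flatten [seq (s : seq 'I_n) | s : n.-bseq 'I_n <- enum Q])
          (enum 'I_n).

Definition lah (n k : nat) : nat :=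
  #|[set Q : {set n.-bseq 'I_n} | ordered_partition Q & #|Q| == k]|.

(* A formal power series in t over {poly R} is its coefficient sequence.
   For f with f 0 = 0, the coefficient of t^n in exp f = sum_k f^k / k! only
   involves k <= n and the coefficients of f of index at most n. *)
Definition fps_exp (R : numFieldType) (f : nat -> {poly R}) (n : nat) :
    {poly R} :=
  \sum_(k < n.+1) (k`!%:R^-1 : R) *: ((\poly_(i < n.+1) f i) ^+ k)`_n.

(* The series t, 1 and x (e^t - 1), where x is the polynomial variable 'X. *)
Definition fps_t (R : numFieldType) (i : nat) : {poly R} := (i == 1%N)%:R.

Definition fps_one (R : numFieldType) (i : nat) : {poly R} := (i == 0%N)%:R.

Definition bell_exponent (R : numFieldType) (i : nat) : {poly R} :=
  'X * (fps_exp (fps_t R) i - fps_one R i).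

(* e^(x (e^t - 1)) = sum_n B_n(x) t^n / n! *)
Definition bell_poly (R : numFieldType) (n : nat) : {poly R} :=
  (n`!%:R : R) *: fps_exp (bell_exponent R) n.

Definition lah_bell_poly (R : numFieldType) (n : nat) : {poly R} :=
  \sum_(l < n.+1) (lah n l)%:R *: 'X^l.

(* Main.v *)
Require Import Defs.
From HB Require Import structures.
From mathcomp Require Import all_boot all_order all_algebra.
From mathcomp Require Import ring.

Import GRing.Theory.

(** The proof is umbral.  For a natural number [m] let [ffact_eval m] be the
    linear form sending ['X^k] to the falling factorial (m)_k = m (m - 1) ...
    (m - k + 1).  A polynomial over a field of characteristic 0 is determined
    by the values of these forms for all [m] ([ffact_eval_inj]), so it suffices
    to compare the two sides under each of them.

    - The Bell polynomial B_n goes to m^n ([ffact_eval_bell]): its generating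
      function exp(x E), with E = e^t - 1, becomes sum_k (m)_k E^k / k!, which
      is (1 + E)^m = e^(m t).

    - The Lah-Bell polynomial of index k goes to the rising factorial
      m (m + 1) ... (m + k - 1) ([ffact_eval_lah_bell]).  Numbering the blocks
      gives k! L(n, k) = n! C(n - 1, n - k) ([lah_closed_form]), because a
      sequence of k nonempty lists is a permutation cut into k pieces; the
      Vandermonde convolution does the rest.

    - Sorting functions by their kernel gives m^n = sum_k S_2(n, k) (m)_k, an
      identity between polynomials in m ([exprn_sum_stirling2]).  Evaluated at
      - m, where (- m)_k is (-1)^k times the rising factorial of m, and
      multiplied by (-1)^n, it reads m^n = sum_k (-1)^(n - k) S_2(n, k)
      m (m + 1) ... (m + k - 1), which is the image of the asserted
      identity. *)

(** * Stirling numbers: powers as sums of falling factorials *)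

Local Open Scope nat_scope.

Lemma eq_preim_partition (T : finType) (rT1 rT2 : eqType) (f : T -> rT1)
    (g : T -> rT2) (D : {set T}) :
  (forall x y, (f x == f y) = (g x == g y)) ->
  preim_partition f D = preim_partition g D.
Proof.
move=> fg; apply: eq_in_imset => x _.
by apply/setP=> y; rewrite !inE /= fg.
Qed.

(** A function whose nonempty fibres are the blocks of [P] amounts to an
    injection from the set of blocks to [E]. *)
Lemma card_ffun_preim_partition (D E : finType) (P : {set {set D}}) :
  partition P [set: D] ->
  #|[set f : {ffun D -> E} | preim_partition f [set: D] == P]| = #|E| ^_ #|P|.
Proof.
move=> partP; have /and3P[/eqP covP tiP nP0] := partP.
have inP x : pblock P x \in P by rewrite pblock_mem // covP inE.
pose B := {A : {set D} | A \in P}.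
pose bl x : B := Sub (pblock P x) (inP x).
have ne (A : B) : exists x, x \in val A.
  apply/set0Pn; apply: contraNneq nP0 => <-; exact: valP.
have blE (A : B) x : x \in val A -> bl x = A.
  by move=> xA; apply: val_inj; apply: def_pblock (valP A) xA.
have -> : #|P| = #|{: B}| by rewrite card_sig; apply: eq_card => A; rewrite inE.
rewrite -card_inj_ffuns.
(* The bijection sends an injection [h] of the blocks to the function
   x |-> h (block of x). *)
pose F (h : {ffun B -> E}) := [ffun x => h (bl x)].
have injF : injective F.
  move=> h h' /ffunP eqF; apply/ffunP=> A; have [x xA] := ne A.
  by have := eqF x; rewrite !ffunE (blE A).
rewrite -(card_imset _ injF); apply: eq_card => f; rewrite inE.
apply/eqP/imsetP => [fP | [h]].
  (* The inverse evaluates [f] at any element of the block. *)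
  exists [ffun A => f (xchoose (ne A))].
    rewrite inE; apply/injectiveP=> A1 A2; rewrite !ffunE.
    set x1 := xchoose _; set x2 := xchoose _ => fx.
    have x1A : x1 \in val A1 by apply: xchooseP.
    have x2A : x2 \in val A2 by apply: xchooseP.
    rewrite -(blE _ _ x1A) -(blE _ _ x2A); apply: val_inj => /=.
    apply/eqP; rewrite eq_pblock ?covP ?inE // -fP.
    by rewrite pblock_equivalence_partition ?inE //= ?fx //; split=> // /eqP->.
  apply/ffunP=> x; rewrite !ffunE; set y := xchoose _.
  have : y \in pblock P x by have := xchooseP (ne (bl x)).
  rewrite -{1}fP pblock_equivalence_partition ?inE //= => [/eqP //|].
  by split=> // /eqP->.
rewrite inE => /injectiveP injh ->.
rewrite -[RHS](preim_partition_pblock partP).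
apply: eq_preim_partition => x y; rewrite !ffunE (inj_eq injh).
by rewrite -(inj_eq val_inj).
Qed.

(** Sort the functions from [n] points to [m] points by their kernel
    partition. *)
Lemma expn_sum_stirling2 m n :
  m ^ n = \sum_(k < n.+1) stirling2 n k * m ^_ k.
Proof.
rewrite -[m in LHS]card_ord -[n in LHS]card_ord -card_ffun -sum1_card.
rewrite (partition_big (fun f : {ffun 'I_n -> 'I_m} =>
           preim_partition f [set: 'I_n])
         (fun P => partition P [set: 'I_n])) /=; last first.
  by move=> f _; apply: preim_partitionP.
(* Blocks are nonempty, so the number of blocks fits in the range of [k]. *)
have cardP (P : {set {set 'I_n}}) : partition P [set: 'I_n] -> #|P| < n.+1.
  move=> /[dup] partP /card_partition; rewrite cardsT card_ord => nE.
  have /and3P[_ _ nP0] := partP.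
  rewrite ltnS [leqRHS]nE -sum1_card leq_sum // => A AP.
  by rewrite card_gt0; apply: contraNneq nP0 => <-.
rewrite (partition_big
  (fun P : {set {set 'I_n}} => inord #|P| : 'I_n.+1) xpredT) //=.
apply: eq_bigr => k _.
rewrite /stirling2 -sum1_card big_distrl /=.
apply: eq_big => [P | P /andP[partP /eqP kE]].
  rewrite inE; case: (boolP (partition _ _)) => //= /cardP Pn.
  by rewrite -val_eqE /= inordK.
rewrite mul1n -kE inordK ?cardP // -[m in RHS]card_ord.
rewrite -card_ffun_preim_partition // -sum1_card.
by apply: eq_bigl => f; rewrite inE.
Qed.

(** * Lah numbers: closed form, and rising factorials *)

(** A repeated block would repeat its elements; only an empty block could
    escape this. *)
Lemma uniq_flatten_nonempty (T : eqType) (ss : seq (seq T)) :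
  all (fun s => s != [::]) ss -> uniq (flatten ss) -> uniq ss.
Proof.
elim: ss => //= s ss IH /andP[s0 ss0]; rewrite cat_uniq => /and3P[_ dis uss].
rewrite IH // andbT; apply: contra dis => sss.
case: s s0 sss => // x s _ sss; apply/hasP; exists x; last exact: mem_head.
by apply/flattenP; exists (x :: s) => //; apply: mem_head.
Qed.

(** The partitions counted by the Lah numbers with, in addition, a numbering of
    their blocks.  The numbering makes them easy to count: cutting a
    permutation of ['I_n] at [k - 1] places produces each of them once. *)
Definition chain_tuples (n k : nat) : {set k.-tuple (n.-bseq 'I_n)} :=
  [set t : k.-tuple (n.-bseq 'I_n) | all (fun s : n.-bseq 'I_n => size s != 0) t
           & perm_eq (flatten (map val t)) (enum 'I_n)].

Lemma chain_tuples_uniq n k (t : k.-tuple (n.-bseq 'I_n)) :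
  t \in chain_tuples n k -> uniq t.
Proof.
rewrite inE => /andP[t0 pt]; rewrite -(map_inj_uniq val_inj).
apply: uniq_flatten_nonempty; last by rewrite (perm_uniq pt) enum_uniq.
by rewrite all_map; apply: sub_all t0 => s /=; rewrite size_eq0.
Qed.

(** The blocks of an ordered partition are distinct, so they can be numbered in
    [k`!] ways: the numberings of [Q] are the duplicate-free [k]-tuples of
    members of [Q]. *)
Lemma card_chain_tuples_lah n k : #|chain_tuples n k| = k`! * lah n k.
Proof.
pose supp (t : k.-tuple (n.-bseq 'I_n)) := [set s in t].
pose Qs := [set Q | @ordered_partition n Q & #|Q| == k].
have pQ (t : k.-tuple _) : uniq t -> perm_eq (enum (supp t)) t.
  move=> ut; apply: uniq_perm; rewrite ?enum_uniq // => s.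
  by rewrite mem_enum inE.
(* Whether a duplicate-free tuple is admissible depends only on its support. *)
have chainE t : (t \in chain_tuples n k) = uniq t && (supp t \in Qs).
  apply/idP/andP => [tC | [ut]].
    have ut := chain_tuples_uniq _ _ _ tC; split=> //.
    move: tC; rewrite !inE => /andP[t0 pt].
    rewrite (cardE (supp t)) (perm_size (pQ _ ut)) size_tuple eqxx andbT.
    apply/andP; split; last first.
      by rewrite (perm_trans _ pt) // perm_flatten // perm_map // pQ.
    by apply/forall_inP=> s; rewrite inE => /(allP t0).
  rewrite !inE => /andP[/andP[/forall_inP s0 pt] _]; apply/andP; split.
    by apply/allP=> s st; apply: s0; rewrite inE.
  by rewrite -(permPl (perm_flatten (perm_map _ (pQ _ ut)))).
rewrite -sum1_card (partition_big supp (mem Qs)) /=; last first.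
  by move=> t; rewrite chainE => /andP[].
rewrite mulnC /lah -/Qs -sum_nat_const; apply: eq_bigr => Q QQs.
have cQ : #|Q| = k by move: QQs; rewrite inE => /andP[_ /eqP].
have <- : #|Q| ^_ k = k`! by rewrite cQ ffactnn.
rewrite sum1_card -card_uniq_tuples; apply: eq_card => t.
rewrite [LHS]unfold_in [RHS]inE /= chainE -andbA.
case: (boolP (uniq t)) => ut; rewrite ?andbF //= andbT.
apply/andP/allP => [[_ /eqP <-] s st | tQ].
  by change (s \in supp t); rewrite inE.
suff -> : supp t = Q by [].
apply/eqP; rewrite eqEcard; apply/andP; split.
  by apply/subsetP=> s; rewrite inE => /tQ.
by rewrite cQ (cardE (supp t)) (perm_size (pQ _ ut)) size_tuple.
Qed.

Lemma sumn_predn (sh : seq nat) :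
  0 \notin sh -> sumn sh = sumn (map predn sh) + size sh.
Proof.
elim: sh => //= m sh IH; rewrite inE negb_or eq_sym -lt0n => /andP[m0 /IH->].
by rewrite -[in LHS](prednK m0) addSn addnS addnA.
Qed.

Lemma leq_sumn (sh : seq nat) m : m \in sh -> m <= sumn sh.
Proof.
elim: sh => //= a sh IH; rewrite inE => /predU1P[-> | /IH le].
  exact: leq_addr.
exact: leq_trans le (leq_addl _ _).
Qed.

(** The compositions of [n] into [k] positive parts, each part lowered by one.
    The form ['C(n.-1, n - k)], unlike ['C(n.-1, k.-1)], is also right for
    [k = 0]: it is 1 for [n = 0] and 0 otherwise. *)
Lemma card_ord_partitions_shifted n k : k <= n ->
  #|[set c : k.-tuple 'I_(n - k).+1 | \sum_(i <- c) i == n - k]|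
    = 'C(n.-1, n - k).
Proof.
case: k => [_ | k kn]; last first.
  have kn1 : k <= n.-1 by rewrite -ltnS (ltn_predK kn).
  rewrite card_ord_partitions.
  have -> : n - k.+1 = n.-1 - k by rewrite -[in LHS](ltn_predK kn) subSS.
  by rewrite subnKC // bin_sub.
case: n => [|n].
  rewrite bin0; apply/eqP/cards1P; exists [tuple].
  by apply/setP=> c; rewrite !inE (tuple0 c) big_nil !eqxx.
rewrite subn0 bin_small //; apply/eqP; rewrite cards_eq0; apply/eqP/setP=> c.
by rewrite !inE (tuple0 c) big_nil.
Qed.

(** A tuple of nonempty lists amounts to its concatenation, a permutation of
    ['I_n], together with the lengths of the lists, a composition of [n]. *)
Lemma card_chain_tuples n k : k <= n ->
  #|chain_tuples n k| = n`! * 'C(n.-1, n - k).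
Proof.
move=> kn.
pose X := [set s : n.-tuple 'I_n | uniq s].
pose Y := [set c : k.-tuple 'I_(n - k).+1 | \sum_(i <- c) i == n - k].
have cX : #|X| = n`!.
  have <- : #|'I_n| ^_ n = n`! by rewrite card_ord ffactnn.
  rewrite -card_uniq_tuples.
  by apply: eq_card => s; rewrite !inE all_predT.
rewrite -card_ord_partitions_shifted // -cX -/Y -cardsX.
(* Lengths are lowered by one so that the compositions become weak ones of
   [n - k].  The defaults in [insubd] and [inord] are never reached on
   [chain_tuples n k]. *)
pose f (t : k.-tuple (n.-bseq 'I_n)) : n.-tuple 'I_n * k.-tuple 'I_(n - k).+1 :=
  (insubd (ord_tuple n) (flatten (map val t)),
   map_tuple (fun s : n.-bseq 'I_n => inord (size s).-1) t).
have shapeE (t : k.-tuple (n.-bseq 'I_n)) : t \in chain_tuples n k ->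
  [/\ size (flatten (map val t)) == n, 0 \notin shape (map val t)
    & sumn (map predn (shape (map val t))) = n - k].
  rewrite inE => /andP[t0 pt].
  have sz : size (flatten (map val t)) = n.
    by rewrite (perm_size pt) size_enum_ord.
  have sh0 : 0 \notin shape (map val t).
    apply/mapP=> -[_ /mapP[s st ->]] /esym/eqP s0.
    by have := allP t0 s st; rewrite s0.
  split=> //; first exact/eqP.
  move: sz; rewrite size_flatten sumn_predn // !size_map size_tuple => sz.
  by apply/eqP; rewrite -(eqn_add2r k) sz subnK.
have f1 t : t \in chain_tuples n k -> val (f t).1 = flatten (map val t).
  by case/shapeE => sz _ _; rewrite insubdK.
have f2 t : t \in chain_tuples n k ->
    map val (f t).2 = map predn (shape (map val t)).
  case/shapeE => _ _ sm; rewrite /= -!map_comp; apply/eq_in_map => s st /=.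
  rewrite inordK // ltnS -sm; apply: leq_sumn; rewrite -map_comp.
  by apply/mapP; exists (val s) => //; apply: map_f.
have f2S t : t \in chain_tuples n k ->
    shape (map val t) = map (succn \o val) (f t).2.
  move=> tC; rewrite map_comp f2 // -map_comp -[LHS]map_id.
  apply/eq_in_map => m mt /=; have [_ sh0 _] := shapeE t tC.
  by rewrite prednK // lt0n; apply: contraNneq sh0 => <-.
have injf : {in chain_tuples n k &, injective f}.
  move=> t t' tC tC' eqf; apply: val_inj; apply: (inj_map val_inj).
  by apply: eq_from_flatten_shape; rewrite -?f1 ?f2S // eqf.
rewrite -(card_in_imset injf); apply: eq_card => -[s c].
rewrite [RHS]in_setX; apply/imsetP/andP => [[t tC fE] | []].
  have -> : s = (f t).1 by rewrite -fE.
  have -> : c = (f t).2 by rewrite -fE.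
  rewrite !inE [tval _](f1 t tC); split.
    by move: tC; rewrite inE => /andP[_ /perm_uniq->]; rewrite enum_uniq.
  rewrite -(big_map val xpredT id) -sumnE f2 //.
  by have [_ _ ->] := shapeE t tC.
rewrite !inE => us; rewrite -(big_map val xpredT id) -sumnE => /eqP sc.
(* Surjectivity: cut [s] into pieces of lengths [sh]. *)
pose sh := map (succn \o val) c.
have shn : sumn sh = n.
  rewrite sumn_predn; last by apply/mapP=> -[].
  by rewrite -map_comp /= sc size_map size_tuple subnK.
pose ss := reshape sh s.
have ssh : shape ss = sh by rewrite reshapeKl // shn size_tuple.
have fss : flatten ss = s by rewrite reshapeKr // shn size_tuple.
have ssn r : r \in ss -> size r <= n.
  by move=> rss; rewrite -[leqRHS]shn leq_sumn // -ssh map_f.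
pose u0 : n.-bseq 'I_n := Bseq (leq0n n : size [::] <= n).
have szt : size (map (insubd u0) ss) == k.
  by rewrite size_map size_reshape size_map size_tuple.
pose t := Tuple szt.
have vt : map val t = ss.
  rewrite /= -map_comp -[RHS]map_id; apply/eq_in_map => r rss /=.
  by rewrite insubdK //; apply: ssn.
have tC : t \in chain_tuples n k.
  rewrite inE vt fss; apply/andP; split.
    have : 0 \notin shape (map val t) by rewrite vt ssh; apply/mapP=> -[].
    move=> sh0; apply/allP=> r rt; apply: contraNneq sh0 => <-.
    by apply: map_f; apply: map_f.
  apply: uniq_perm; rewrite ?enum_uniq // => i; rewrite mem_enum.
  have [| | _ ->] := uniq_min_size us (s2 := enum 'I_n).
  - by move=> j _; rewrite mem_enum.
  - by rewrite size_enum_ord size_tuple.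
  - by rewrite mem_enum.
exists t => //.
have eq1 : (f t).1 = s by apply: val_inj; rewrite f1 // vt fss.
have eq2 : (f t).2 = c.
  apply: val_inj; apply: (inj_map val_inj); rewrite f2 // vt ssh -map_comp.
  exact: eq_map.
by rewrite -eq1 -eq2; case: (f t).
Qed.

Lemma lah_closed_form n k : k <= n -> k`! * lah n k = n`! * 'C(n.-1, n - k).
Proof. by move=> kn; rewrite -card_chain_tuples_lah card_chain_tuples. Qed.

(** After multiplication of the closed form by ['C(m, k)] this is the
    Vandermonde convolution.  The right-hand side is the rising factorial
    m (m + 1) ... (m + n - 1). *)
Lemma sum_lah_ffact m n :
  \sum_(k < n.+1) lah n k * m ^_ k = (m + n.-1) ^_ n.
Proof.
rewrite -bin_ffact -binomial.Vandermonde big_distrl; apply: eq_bigr => k _ /=.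
rewrite -bin_ffact mulnCA -mulnA; congr (_ * _).
by rewrite mulnC [RHS]mulnC lah_closed_form // -ltnS.
Qed.

(** * The umbral functional *)

Local Open Scope ring_scope.

(** The umbral functional ['X^k] |-> [m ^_ k]. *)
Definition ffact_eval {R : nzRingType} (m : nat) (p : {poly R}) : R :=
  \sum_(k < size p) p`_k * (m ^_ k)%:R.

(** A summation range independent of the degree, so that several polynomials can
    be compared. *)
Lemma ffact_eval_wide {R : nzRingType} m N (p : {poly R}) :
  (size p <= N)%N -> ffact_eval m p = \sum_(k < N) p`_k * (m ^_ k)%:R.
Proof.
move=> szN; rewrite /ffact_eval.
rewrite (big_ord_widen N (fun k => p`_k * (m ^_ k)%:R)) //.
rewrite big_mkcond; apply: eq_bigr => k _; case: ltnP => // szk.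
by rewrite nth_default ?mul0r.
Qed.

Lemma ffact_eval_is_linear (R : comNzRingType) m :
  linear_for *%R (@ffact_eval R m).
Proof.
move=> a p q.
pose N := maxn (size (a *: p + q)) (maxn (size p) (size q)).
rewrite !(ffact_eval_wide m N) ?leq_max ?leqnn ?orbT //.
rewrite mulr_sumr -big_split; apply: eq_bigr => k _ /=.
by rewrite coefD coefZ mulrDl mulrA.
Qed.

HB.instance Definition _ (R : comNzRingType) m :=
  GRing.isLinear.Build R {poly R} R *%R (@ffact_eval R m)
    (@ffact_eval_is_linear R m).

Lemma ffact_evalXn (R : nzRingType) m k :
  ffact_eval m ('X^k : {poly R}) = (m ^_ k)%:R.
Proof.
rewrite /ffact_eval size_polyXn big_ord_recr /= big1 ?add0r => [|i _].
  by rewrite coefXn eqxx mul1r.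
by rewrite coefXn (ltn_eqF (ltn_ord i)) mul0r.
Qed.

(** [k ^_ i] vanishes for [i > k], so the values at [0, 1, 2, ...] form a
    triangular system for the coefficients, with the diagonal entries [k`!]
    nonzero in characteristic 0. *)
Lemma ffact_eval_inj (R : numFieldType) (p q : {poly R}) :
  (forall m, ffact_eval m p = ffact_eval m q) -> p = q.
Proof.
move=> pq; apply/eqP; rewrite -subr_eq0; set r := p - q; apply/eqP.
have r0 m : ffact_eval m r = 0 by rewrite raddfB /= pq subrr.
apply/polyP=> k; rewrite coef0.
elim/ltn_ind: k => k IH.
have := r0 k; rewrite (ffact_eval_wide k (size r + k.+1)) ?leq_addr //.
rewrite (bigD1 (Ordinal (leq_addl (size r) k.+1))) //= big1 ?addr0 => [|i ik].
  move/eqP; rewrite mulf_eq0 Num.Theory.pnatr_eq0 ffactnn.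
  by rewrite eqn0Ngt fact_gt0 orbF => /eqP.
case: (ltngtP i k) => [/IH-> | ki | iE]; first by rewrite mul0r.
  by rewrite ffact_small ?mulr0.
by rewrite -val_eqE /= iE eqxx in ik.
Qed.

(** * Falling factorials as polynomials *)

Definition ffact_poly (R : nzRingType) (n : nat) : {poly R} :=
  \prod_(i < n) ('X - i%:R%:P).

Lemma ffact_poly_nat (R : comNzRingType) n m :
  (ffact_poly R n).[m%:R] = (m ^_ n)%:R.
Proof.
rewrite horner_prod ffact_prod natr_prod.
case: (leqP n m) => [nm | mn].
  apply: eq_bigr => i _.
  by rewrite hornerXsubC natrB // (leq_trans _ nm) // ltnW.
(* For [m < n] both products contain the factor of index [m], which is 0. *)
rewrite (bigD1 (Ordinal mn)) //= [RHS](bigD1 (Ordinal mn)) //=.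
by rewrite hornerXsubC subrr subnn !mul0r.
Qed.

(** At a negative integer the falling factorial is, up to sign, a rising one;
    this is where the Lah numbers meet the Stirling numbers. *)
Lemma ffact_poly_oppnat (R : comNzRingType) n m :
  (ffact_poly R n).[- m%:R] = (-1) ^+ n * ((m + n.-1) ^_ n)%:R.
Proof.
(* The two products list the factors m, ..., m + n - 1 in opposite orders. *)
rewrite horner_prod ffact_prod natr_prod (reindex_inj rev_ord_inj) /=.
rewrite -[in (-1) ^+ n](card_ord n) -prodr_const -big_split.
apply: eq_bigr => i _ /=; rewrite hornerXsubC mulN1r -opprD -natrD.
congr (- _%:R).
case: n i => [[] // | n i] /=.
by rewrite subSS addnBA // -ltnS.
Qed.

(** Both sides are polynomials in [x] that agree at every natural number, hence
    everywhere, in particular at the integers [- m]. *)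
Lemma exprn_sum_stirling2 (R : numFieldType) n (x : R) :
  x ^+ n = \sum_(k < n.+1) (stirling2 n k)%:R * (ffact_poly R k).[x].
Proof.
pose d : {poly R} :=
  'X^n - \sum_(k < n.+1) (stirling2 n k)%:R *: ffact_poly R k.
suff d0 : d = 0.
  have : d.[x] = 0 by rewrite d0 horner0.
  rewrite hornerD hornerN hornerXn horner_sum => /eqP.
  rewrite subr_eq0 => /eqP->.
  by apply: eq_bigr => k _; rewrite hornerZ.
apply: (@roots_geq_poly_eq0 _ _ [seq m%:R | m <- iota 0 (size d)]).
- apply/allP=> _ /mapP[m _ ->].
  rewrite rootE hornerD hornerN hornerXn horner_sum.
  rewrite -natrX expn_sum_stirling2 natr_sum subr_eq0; apply/eqP/eq_bigr=> k _.
  by rewrite hornerZ ffact_poly_nat natrM.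
- rewrite map_inj_uniq ?iota_uniq //.
  exact: (Num.Theory.mulrIn (oner_neq0 R)).
- by rewrite size_map size_iota.
Qed.

(** * Images of the Lah-Bell and Bell polynomials *)

Lemma ffact_eval_lah_bell (R : numFieldType) n m :
  ffact_eval m (lah_bell_poly R n) = ((m + n.-1) ^_ n)%:R.
Proof.
rewrite -sum_lah_ffact natr_sum linear_sum; apply: eq_bigr => k _.
by rewrite linearZ /= ffact_evalXn natrM.
Qed.

(** In the defining sum only [k = i] contributes, since the truncation of the
    series [t] is ['X] (or 0 when [i = 0]). *)
Lemma fps_exp_tE (R : numFieldType) i : fps_exp (fps_t R) i = (i`!%:R^-1)%:P.
Proof.
rewrite /fps_exp.
have tE : \poly_(j < i.+1) fps_t R j = if i is 0 then 0 else 'X.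
  apply/polyP=> j; rewrite coef_poly /fps_t; case: i => [|i].
    by rewrite coef0; case: j.
  by rewrite coefX; case: j => [|[|j]] //=; case: ifP.
rewrite tE (bigD1 ord_max) //= big1 ?addr0 => [|k ki].
  case: i {tE} => [|i]; first by rewrite expr0 coef1 alg_polyC.
  by rewrite coefXn eqxx alg_polyC.
case: i k ki {tE} => [|i] k ki.
  by case/eqP: ki; apply: val_inj; case: k => -[].
rewrite coefXn; case: eqP => [iE | _]; last by rewrite scaler0.
by case/eqP: ki; apply: val_inj.
Qed.

Definition exp_trunc (R : numFieldType) (n : nat) : {poly R} :=
  \poly_(i < n.+1) i`!%:R^-1.

Lemma bell_exponent_trunc (R : numFieldType) n :
  \poly_(i < n.+1) bell_exponent R i =
    'X%:P * map_poly polyC (exp_trunc R n - 1).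
Proof.
apply/polyP=> i; rewrite coef_poly coefCM coef_map /= coefB coef_poly coef1.
case: ltnP => [_ | ni]; rewrite /bell_exponent /fps_one ?fps_exp_tE.
  by rewrite polyCB; case: i => //= i; rewrite polyC0 ?subr0.
by case: i ni => // i _; rewrite subr0 polyC0 mulr0.
Qed.

Lemma bell_polyE (R : numFieldType) n :
  bell_poly R n =
  \sum_(k < n.+1) (n`!%:R / k`!%:R * ((exp_trunc R n - 1) ^+ k)`_n) *: 'X^k.
Proof.
rewrite /bell_poly /fps_exp scaler_sumr; apply: eq_bigr => k _.
rewrite bell_exponent_trunc exprMn -rmorphXn -rmorphXn /= coefCM coef_map /=.
by rewrite mulrC mul_polyC !scalerA.
Qed.

(** e^t to the power [m] is e^(m t), and truncation at order [n] does not affect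
    the coefficients up to [n]. *)
Lemma coef_exp_truncX (R : numFieldType) n m i : (i <= n)%N ->
  (exp_trunc R n ^+ m)`_i = m%:R ^+ i / i`!%:R.
Proof.
elim: m i => [|m IH] i le_in.
  by rewrite expr0 coef1 expr0n; case: i le_in => [|i] _; rewrite ?mul0r ?divr1.
rewrite exprSr coefM -natr1 [m%:R + 1]addrC exprDn mulr_suml.
apply: eq_bigr => -[j /= ji] _; rewrite ltnS in ji.
rewrite IH ?(leq_trans ji) // coef_poly ltnS (leq_trans (leq_subr _ _)) //.
have nz k : k`!%:R != 0 :> R by rewrite Num.Theory.pnatr_eq0 -lt0n fact_gt0.
have nzb : 'C(i, j)%:R != 0 :> R by rewrite Num.Theory.pnatr_eq0 -lt0n bin_gt0.
rewrite expr1n mul1r -[_ *+ 'C(i, j)]mulr_natr -(bin_fact ji) !natrM.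
by set y := _ ^+ j; field; rewrite nzb !nz.
Qed.

(** With E = e^t - 1, the coefficient of ['X^k] in B_n is n! [t^n] E^k / k!.
    Replacing ['X^k] by m (m - 1) ... (m - k + 1) turns the sum over [k] into
    n! [t^n] of the binomial expansion of (1 + E)^m = e^(m t), that is, into
    m^n. *)
Lemma ffact_eval_bell (R : numFieldType) n m :
  ffact_eval m (bell_poly R n) = (m ^ n)%:R.
Proof.
have nz k : k`!%:R != 0 :> R by rewrite Num.Theory.pnatr_eq0 -lt0n fact_gt0.
set E := exp_trunc R n - 1.
(* [E] is divisible by ['X], so its [k]-th power has no terms below ['X^k]. *)
have E0 k : (n < k)%N -> (E ^+ k)`_n = 0.
  move=> nk; have /factor_theorem[F EF] : root E 0.
    by rewrite /root hornerD hornerN hornerC horner_coef0 coef_poly invr1 subrr.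
  by rewrite EF subr0 exprMn coefMXn nk.
rewrite bell_polyE linear_sum /=.
transitivity (n`!%:R * \sum_(k < n.+1) (E ^+ k)`_n * 'C(m, k)%:R).
  rewrite mulr_sumr; apply: eq_bigr => k _; rewrite linearZ /= ffact_evalXn.
  by rewrite -bin_ffact natrM -/E; set e := _`_n; field; rewrite nz.
pose G k := (E ^+ k)`_n * 'C(m, k)%:R.
(* [G k] vanishes beyond [n] by [E0] and beyond [m] because of the binomial,
   so the binomial theorem applies although the ranges differ. *)
have -> : \sum_(k < n.+1) G k = \sum_(k < m.+1) G k.
  rewrite (big_ord_widen (n + m).+1 G) ?ltnS ?leq_addr //.
  rewrite [RHS](big_ord_widen (n + m).+1 G) ?ltnS ?leq_addl //.
  rewrite big_mkcond [RHS]big_mkcond; apply: eq_bigr => k _; rewrite /G.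
  case: ltnP => nk; case: ltnP => mk //; first by rewrite bin_small ?mulr0.
  by rewrite E0 ?mul0r.
have := coef_exp_truncX R n m n (leqnn n).
have -> : exp_trunc R n = 1 + E by rewrite addrC subrK.
rewrite exprDn coef_sum => eqE.
have -> : \sum_(k < m.+1) G k = m%:R ^+ n / n`!%:R.
  rewrite -eqE; apply: eq_bigr => k _.
  by rewrite expr1n mul1r coefMn /G mulr_natr.
by rewrite mulrC mulfVK // natrX.
Qed.

(** * The identity *)

Theorem theorem5 (R : numFieldType) (n : nat) :
  bell_poly R n =
  \sum_(k < n.+1) ((-1) ^+ (n - k) * (stirling2 n k)%:R) *: lah_bell_poly R k.
Proof.
apply: ffact_eval_inj => m; rewrite ffact_eval_bell linear_sum /= natrX.
(* Expanding [m ^+ n] at [- m] instead of [m] brings in rising factorials, the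
   images of the Lah-Bell polynomials. *)
have -> : m%:R ^+ n = (-1) ^+ n * (- m%:R) ^+ n :> R.
  by rewrite -exprMn mulN1r opprK.
rewrite (exprn_sum_stirling2 _ _ (- m%:R)) mulr_sumr.
apply: eq_bigr => -[k /= kn] _.
rewrite linearZ /= ffact_eval_lah_bell ffact_poly_oppnat.
rewrite ltnS in kn; rewrite -[in (-1) ^+ n](subnK kn) exprD.
rewrite -!mulrA; congr (_ * _).
by rewrite mulrCA -[(-1) ^+ k]signr_odd signrMK.
Qed.
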